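(* Let $1<p<\infty$, $\lambda_\pm>0$, $0<\gamma<\min\left\{1,\frac{p\alpha_p}{1+\alpha_p}\right\}$, and let $u$ be a local minimizer of $\mathcal{J}$. For any open $\Omega'\Subset\Omega$, one has $$\mathcal{L}^N(\Gamma_*\cap\Omega')=0 .$$
   Context: $\Omega\subset\mathbb{R}^N$ is open and bounded with Lipschitz boundary. The functional is $$\mathcal{J}[u]:=\int_\Omega \frac{|\nabla u|^p}{p}+F_\gamma(u)\,dx,\qquad F_\gamma(u):=\lambda_+(u_+)^\gamma+\lambda_-(u_-)^\gamma,\qquad u_\pm:=\max\{\pm u,0\}.$$ A function $u\in W^{1,p}(\Omega)$ is a local minimizer of $\mathcal{J}$ if $\mathcal{J}[u]\le\mathcal{J}[u+\varphi]$ for every open $\Omega'\Subset\Omega$ and every $\varphi\in W^{1,p}_0(\Omega')$ (extended by zero). Local minimizers belong to $C^{1,\alpha}_{\mathrm{loc}}(\Omega)$ for some $\alpha\in(0,1)$. The nonbranching two-phase free boundary is $\Gamma_*:=(\partial\{u>0\}\cap\partial\{u<0\})\cap\{\nabla u\ne0\}\cap\Omega$. $\alpha_p\in(0,1)$ (depending only on $N,p$) denotes the optimal Hölder exponent for the gradient of $p$-harmonic functions in $\mathbb{R}^N$. $\mathcal{L}^N$ is $N$-dimensional Lebesgue measure. *)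

(* Defs.v *)
From HB Require Import structures.
From mathcomp Require Import all_boot all_order all_algebra.
From mathcomp Require Import all_classical all_reals all_analysis.

Set Implicit Arguments.
Unset Strict Implicit.
Unset Printing Implicit Defensive.
Import Order.TTheory GRing.Theory Num.Theory.
Import numFieldNormedType.Exports.

Local Open Scope classical_set_scope.
Local Open Scope ring_scope.

(* The measurable sets of R^n are those generated by the coordinate maps, as
   for n-tuples in MathComp-Analysis; this is the Borel sigma-algebra. *)

Definition measure_rV_display : measure_display -> measure_display.
Proof. exact. Qed.

Section measurable_rV.
Context {d} {T : measurableType d}.
Variable n : nat.

Let coors : 'I_n -> 'rV[T]_n -> T := fun i v => v 0 i.

Let rV_set0 : g_sigma_preimage coors set0.
Proof. exact: sigma_algebra0. Qed.

Let rV_setC A : g_sigma_preimage coors A -> g_sigma_preimage coors (~` A).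
Proof. exact: sigma_algebraC. Qed.

Let rV_bigcup (F : _^nat) : (forall i, g_sigma_preimage coors (F i)) ->
  g_sigma_preimage coors (\bigcup_i (F i)).
Proof. exact: sigma_algebra_bigcup. Qed.

HB.instance Definition _ := @isMeasurable.Build (measure_rV_display d)
  'rV[T]_n (g_sigma_preimage coors) rV_set0 rV_setC rV_bigcup.

Lemma measurable_coor (i : 'I_n) :
  measurable_fun [set: 'rV[T]_n] (fun v : 'rV[T]_n => v 0 i).
Proof.
move=> _ Y mY; rewrite setTI; apply: sub_sigma_algebra => /=.
rewrite -bigcup_seq/=; exists i => /=; first by rewrite mem_index_enum.
by exists Y => //; rewrite setTI.
Qed.

Lemma measurable_fun_rVP d1 (T1 : measurableType d1) (f : T1 -> 'rV[T]_n) :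
  (forall i, measurable_fun [set: T1] (fun x => f x 0 i)) ->
  measurable_fun [set: T1] f.
Proof.
move=> mf.
suff sub : g_sigma_preimage (fun i => coors i \o f) `<=` measurable.
  move=> _ A mA; apply: sub; rewrite g_sigma_preimage_comp.
  by exists A.
apply: smallest_sub; first exact: sigma_algebra_measurable.
rewrite -bigcup_seq; apply: bigcup_sub => i _ A [B mB <-].
exact: mf.
Qed.

End measurable_rV.

Section sigma_finite_measure_of.
Context d (T : measurableType d) (R : realType).
Variable mu : {measure set T -> \bar R}.
Hypothesis sf : sigma_finite setT mu.

Let m : set T -> \bar R := mu.

#[local] HB.instance Definition _ := Measure.on m.
#[local] HB.instance Definition _ := Measure_isSigmaFinite.Build _ _ _ m sf.

Definition sigma_finite_measure_of : {sigma_finite_measure set T -> \bar R} := m.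

End sigma_finite_measure_of.

Section lebesgue_rV.
Context {R : realType}.

Definition cons_rV n (xv : measurableTypeR R * 'rV[R]_n) : 'rV[R]_n.+1 :=
  \row_(i < n.+1) oapp (fun j => xv.2 0 j) xv.1 (unlift ord0 i).

Lemma measurable_cons_rV n : measurable_fun setT (@cons_rV n).
Proof.
apply: measurable_fun_rVP => i.
under eq_fun do rewrite mxE.
case: (unlift ord0 i) => [j|] /=; last exact: measurable_fst.
exact: (measurableT_comp (measurable_coor j)).
Qed.

(* Lebesgue measure on R^n: a point mass on R^0, and the image of the product
   of the measures of R and R^n under (x, v) |-> (x, v_0, ..., v_(n-1)). *)
Fixpoint lebesgue_rV n : set 'rV[R]_n -> \bar R :=
  match n with
  | 0%N => \d_(0 : 'rV[R]_0)
  | m.+1 => pushforward (lebesgue_measure \x @lebesgue_rV m)%E (@cons_rV m)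
  end.

Let cons_rV_inv n (v : 'rV[R]_n.+1) : measurableTypeR R * 'rV[R]_n :=
  (v 0 0, \row_j v 0 (lift ord0 j)).

Let measurable_cons_rV_inv n : measurable_fun setT (@cons_rV_inv n).
Proof.
apply: measurable_fun_pair => /=; first exact: measurable_coor.
apply: measurable_fun_rVP => i; under eq_fun do rewrite mxE.
exact: measurable_coor.
Qed.

Let cons_rVK n : cancel (@cons_rV n) (@cons_rV_inv n).
Proof.
case=> x v; congr pair; first by rewrite mxE unlift_none.
by apply/rowP => j; rewrite !mxE liftK.
Qed.

Let lebesgue_rV_measure n :
  {m : {sigma_finite_measure set 'rV[R]_n -> \bar R} |
   m = @lebesgue_rV n :> (set _ -> _)}.
Proof.
elim: n => [|n [m mE]]; first by exists \d_(0 : 'rV[R]_0).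
have mc := @measurable_cons_rV n.
have sf : sigma_finite setT
    (pushforward (lebesgue_measure \x m)%E (@cons_rV n)).
  pose leb : {sigma_finite_measure set (measurableTypeR R) -> \bar R} :=
    lebesgue_measure.
  have /sigma_finiteP[F [TF ndF Foo]] := sigma_finiteT leb.
  have /sigma_finiteP[G [TG ndG Goo]] := sigma_finiteT m.
  exists (fun k => @cons_rV_inv n @^-1` (F k `*` G k)).
    rewrite -preimage_bigcup; apply/esym/seteqP; split => // v _ /=.
    have [k _ Fk] : (\bigcup_k F k) (v 0 0) by rewrite -TF.
    have [l _ Gl] : (\bigcup_k G k) (@cons_rV_inv n v).2 by rewrite -TG.
    exists (maxn k l) => //; split => /=.
      by move: Fk; exact/subsetPset/ndF/leq_maxl.
    by move: Gl; exact/subsetPset/ndG/leq_maxr.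
  move=> k; have [? ?] := Foo k; have [? ?] := Goo k; split.
    rewrite -[X in measurable X]setTI; apply: measurable_cons_rV_inv => //.
    exact: measurableX.
  rewrite /pushforward -comp_preimage (_ : _ \o _ = id); last first.
    by apply/funext => x /=; rewrite cons_rVK.
  by rewrite preimage_id product_measure1E// lte_mul_pinfty// ge0_fin_numE.
pose mu : {measure set 'rV[R]_n.+1 -> \bar R} :=
  measure_function_pushforward__canonical__measure_function_Measure
    (lebesgue_measure \x m)%E mc.
by exists (sigma_finite_measure_of (mu := mu) sf) => /=; rewrite mE.
Qed.

Let lebesgue_rV0 n : @lebesgue_rV n set0 = 0%E.
Proof. by have [m <-] := lebesgue_rV_measure n; rewrite measure0. Qed.

Let lebesgue_rV_ge0 n A : (0 <= @lebesgue_rV n A)%E.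
Proof. by have [m <-] := lebesgue_rV_measure n; exact: measure_ge0. Qed.

Let lebesgue_rV_sigma_additive n : semi_sigma_additive (@lebesgue_rV n).
Proof.
have [m <-] := lebesgue_rV_measure n; exact: measure_semi_sigma_additive.
Qed.

Let lebesgue_rV_sigma_finite n : sigma_finite setT (@lebesgue_rV n).
Proof. by have [m <-] := lebesgue_rV_measure n; exact: sigma_finiteT. Qed.

HB.instance Definition _ n := isMeasure.Build _ _ _ (@lebesgue_rV n)
  (@lebesgue_rV0 n) (@lebesgue_rV_ge0 n) (@lebesgue_rV_sigma_additive n).

HB.instance Definition _ n := Measure_isSigmaFinite.Build _ _ _
  (@lebesgue_rV n) (@lebesgue_rV_sigma_finite n).

Lemma measurable_rV_box n (A : 'I_n -> set R) : (forall i, measurable (A i)) ->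
  measurable [set v : 'rV[R]_n | forall i, A i (v 0 i)].
Proof.
move=> mA.
rewrite (_ : mkset _ = \bigcap_(i in [set: 'I_n])
    ((fun v : 'rV[R]_n => v 0 i) @^-1` A i)); last first.
  by apply/seteqP; split => v /= h i; [move=> _|]; exact: h.
apply: fin_bigcap_measurable => [|i _]; first exact: finite_finset.
by rewrite -[X in measurable X]setTI; exact: measurable_coor.
Qed.

Lemma lebesgue_rV_box n (A : 'I_n -> set R) : (forall i, measurable (A i)) ->
  lebesgue_rV [set v : 'rV[R]_n | forall i, A i (v 0 i)] =
  (\prod_(i < n) lebesgue_measure (A i))%E.
Proof.
elim: n A => [|n IHn] A mA.
  by rewrite big_ord0 /= diracE mem_set// => -[].
rewrite big_ord_recl -IHn; last by move=> i; exact: mA.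
have [m mE] := lebesgue_rV_measure n.
rewrite /= /pushforward -mE -product_measure1E//; [|exact: mA|]; last first.
  by apply: (@measurable_rV_box n (fun i => A (lift ord0 i))).
apply: (congr1 (lebesgue_measure \x m)%E).
apply/seteqP; split => -[x v] /= h.
  split; first by have := h ord0; rewrite mxE unlift_none.
  by move=> i; have := h (lift ord0 i); rewrite mxE liftK.
move=> i; rewrite mxE; case: unliftP => [j ->|->] /=; last exact: h.1.
exact: h.2.
Qed.

End lebesgue_rV.

Section euclidean.
Context {R : realType} {N : nat}.
Implicit Types (x y : 'rV[R]_N) (A B U : set 'rV[R]_N) (f : 'rV[R]_N -> R).

(* The library norm on 'rV[R]_N is the sup norm, hence the following. *)
Definition dotmul x y : R := \sum_(i < N) x 0 i * y 0 i.

Definition enorm x : R := Num.sqrt (dotmul x x).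

Definition boundary A : set 'rV[R]_N := closure A `\` A°.

(* A is compactly contained in B. *)
Definition compactly_contained A B := compact (closure A) /\ closure A `<=` B.

(* In a ball around each boundary point, and up to a rotation, U is the part of
   space above the graph of a Lipschitz function of the N - 1 coordinates
   orthogonal to nu. *)
Definition lipschitz_boundary U := forall x0, boundary U x0 ->
  exists (r L : R) (nu : 'rV[R]_N) (g : 'rV[R]_N -> R),
  [/\ 0 < r, enorm nu = 1, forall x y, `|g x - g y| <= L * enorm (x - y) &
      forall x, enorm (x - x0) < r ->
        (U x <-> g (x - dotmul x nu *: nu) < dotmul x nu)].

Definition partial (i : 'I_N) f : 'rV[R]_N -> R :=
  fun x => 'D_(delta_mx 0 i) f x.

Definition grad f x : 'rV[R]_N := \row_i partial i f x.

Definition smooth f :=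
  forall (s : seq 'I_N) x, differentiable (foldr partial f s) x.

Definition test_fun U f :=
  smooth f /\ compactly_contained [set x | f x != 0] U.

(* f is of class C^{1,a} on every compact subset of U. *)
Definition C1_holder_loc U (a : R) f :=
  (forall x, U x -> differentiable f x) /\
  forall K, compact K -> K `<=` U -> exists C : R, forall x y, K x -> K y ->
    enorm (grad f x - grad f y) <= C * enorm (x - y) `^ a.

End euclidean.

Section sobolev.
Context {R : realType} {N : nat}.
Implicit Types (U V : set 'rV[R]_N) (p : R) (f u : 'rV[R]_N -> R)
  (G : 'rV[R]_N -> 'rV[R]_N).

Let mu := @lebesgue_rV R N.

Definition ae_eq_on U f u := {ae mu, forall x, U x -> f x = u x}.

Definition locally_integrable_on U f := forall K, compact K -> K `<=` U ->
  mu.-integrable K (EFin \o f).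

Definition weak_gradient U u G :=
  [/\ locally_integrable_on U u,
      forall i, locally_integrable_on U (fun x => G x 0 i) &
      forall i (phi : 'rV[R]_N -> R), test_fun U phi ->
        \int[mu]_(x in U) (u x * partial i phi x) =
        - \int[mu]_(x in U) (G x 0 i * phi x)].

(* A weak gradient of u, which is unique almost everywhere in U. *)
Definition wgrad U u : 'rV[R]_N -> 'rV[R]_N := xget (cst 0) (weak_gradient U u).

Definition in_Lp U p f := measurable_fun U f /\
  (\int[mu]_(x in U) (`|f x| `^ p)%:E < +oo)%E.

Definition W1p U p u := in_Lp U p u /\
  exists2 G, weak_gradient U u G & forall i, in_Lp U p (fun x => G x 0 i).

Definition W1p_norm U p u : \bar R :=
  ((\int[mu]_(x in U) (`|u x| `^ p)%:E +
    \int[mu]_(x in U) (enorm (wgrad U u x) `^ p)%:E) `^ p^-1)%E.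

(* The closure of the test functions in W^{1,p}(U). *)
Definition W1p0 U p u := W1p U p u /\
  forall e : R, 0 < e ->
    exists2 phi, test_fun U phi & (W1p_norm U p (u \- phi)%R < e%:E)%E.

Definition p_harmonic U p h := forall V, open V -> compactly_contained V U ->
  W1p V p h /\
  forall phi, test_fun V phi ->
    \int[mu]_(x in V) (enorm (wgrad V h x) `^ (p - 2) *
                       dotmul (wgrad V h x) (grad phi x)) = 0.

End sobolev.

(* The supremum of the exponents a for which the gradients of all p-harmonic
   functions, on any open set of R^N, are locally a-Hoelder continuous. *)
Definition alpha_p (R : realType) (N : nat) (p : R) : R :=
  sup [set a : R | 0 < a < 1 /\
    forall (U : set 'rV[R]_N) (h : 'rV[R]_N -> R), open U -> p_harmonic U p h ->
      exists2 w, ae_eq_on U w h & C1_holder_loc U a w].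

Section functional.
Context {R : realType} {N : nat}.
Implicit Types (Omega : set 'rV[R]_N) (p lp lm gamma : R) (u v : 'rV[R]_N -> R).

Definition F_gamma lp lm gamma (t : R) : R :=
  lp * Num.max t 0 `^ gamma + lm * Num.max (- t) 0 `^ gamma.

Definition J_functional Omega p lp lm gamma u : \bar R :=
  (\int[@lebesgue_rV R N]_(x in Omega)
    (enorm (wgrad Omega u x) `^ p / p + F_gamma lp lm gamma (u x))%:E)%E.

Definition local_minimizer Omega p lp lm gamma u :=
  W1p Omega p u /\
  forall (Omega' : set 'rV[R]_N) (phi : 'rV[R]_N -> R),
    open Omega' -> compactly_contained Omega' Omega -> W1p0 Omega' p phi ->
    (J_functional Omega p lp lm gamma u <=
     J_functional Omega p lp lm gamma (u \+ (phi \_ Omega'))%R)%E.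

(* v is the C^{1,a}_loc function, for some a in (0,1), which represents the
   Sobolev class of u and through which u is evaluated pointwise. *)
Definition C1_holder_representative Omega u v :=
  ae_eq_on Omega v u /\ exists2 a : R, 0 < a < 1 & C1_holder_loc Omega a v.

Definition Gamma_star Omega v : set 'rV[R]_N :=
  boundary [set x | Omega x /\ 0 < v x] `&`
  boundary [set x | Omega x /\ v x < 0] `&`
  [set x | grad v x != 0] `&` Omega.

End functional.

(* Main.v *)
(* Minimality enters only through the C^1 regularity of v. At a point of
   Gamma_star, v vanishes and some partial derivative does not. On a line in the
   direction of that derivative such zeros are isolated, hence countably many,
   and Fubini's theorem in that direction makes the set of them null. *)

Require Import Defs.
From mathcomp Require Import all_boot all_order all_algebra.
From mathcomp Require Import all_classical all_reals all_analysis.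

Set Implicit Arguments.
Unset Strict Implicit.
Unset Printing Implicit Defensive.
Import Order.TTheory GRing.Theory Num.Theory.
Import numFieldNormedType.Exports.

Local Open Scope classical_set_scope.
Local Open Scope ring_scope.

(** The sigma-algebra is generated by the coordinates, not by the topology. An open set is the
    countable union of the boxes with rational corners that it contains. *)
Lemma open_measurable_rV (R : realType) (n : nat) (U : set 'rV[R]_n) :
  open U -> measurable U.
Proof.
move=> oU.
pose box (q : 'rV[rat]_n * 'rV[rat]_n) : set 'rV[R]_n :=
  [set v | forall i, `](ratr (q.1 0 i) : R), ratr (q.2 0 i)[%classic (v 0 i)].
have -> : U = \bigcup_q (if `[< box q `<=` U >] then box q else set0).
  apply/seteqP; split => [x Ux|x [q _]]; last by case: asboolP => // qU /qU.
  have /nbhs_ballP[e /= e0 xeU] := open_nbhs_nbhs (conj oU Ux).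
  (* Rational corners within [e] of [x] in each coordinate: balls are those of the sup norm, so the
     box lies in the ball of radius [e]. *)
  have Pl i : {q : rat | ratr q \in `]x 0 i - e, x 0 i[}.
    by apply/cid/(@rat_in_itvoo R); rewrite ltrBlDr ltrDl.
  have Pr i : {q : rat | ratr q \in `]x 0 i, x 0 i + e[}.
    by apply/cid/(@rat_in_itvoo R); rewrite ltrDl.
  exists (\row_i sval (Pl i), \row_i sval (Pr i)) => //.
  rewrite asboolT => [i /=|y /= xy].
    rewrite !mxE in_itv /=; case: (Pl i) => a /=; case: (Pr i) => b /=.
    by rewrite !in_itv /= => /andP[-> _] /andP[_ ->].
  apply: xeU; split => // i j; rewrite ord1.
  have := xy j; rewrite /= !mxE; case: (Pl j) => a /=; case: (Pr j) => b /=.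
  rewrite !in_itv /= => /andP[_ be] /andP[ae _] /andP[ay yb].
  rewrite /ball /= ltr_distlC (lt_trans ae ay) /=.
  exact: lt_trans yb be.
apply: countable_bigcupT_measurable => [|q]; first exact: countableP.
case: asboolP => // _.
apply: (@measurable_rV_box R n
  (fun i => `](ratr (q.1 0 i) : R), ratr (q.2 0 i)[%classic)) => i.
exact: measurable_itv.
Qed.

Lemma closed_measurable_rV (R : realType) (n : nat) (A : set 'rV[R]_n) :
  closed A -> measurable A.
Proof.
by move=> /closed_openC/open_measurable_rV/measurableC; rewrite setCK.
Qed.

Lemma boundary_measurable (R : realType) (n : nat) (A : set 'rV[R]_n) :
  measurable (boundary A).
Proof.
rewrite /boundary; apply: measurableD.
  apply: closed_measurable_rV; exact: (@closed_closure _ A).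
by apply: open_measurable_rV; exact: open_interior.
Qed.

(** Induction on the dimension, following the recursive definition of the measure: the first
    coordinate is split off, and the order of integration depends on whether it is the direction
    [i]. *)
Lemma lebesgue_rV_countable_lines (R : realType) (n : nat) (i : 'I_n)
    (A : set 'rV[R]_n) :
  measurable A ->
  (forall x, countable [set t : R | A (x + t *: delta_mx 0 i)]) ->
  lebesgue_rV A = 0%E.
Proof.
elim: n i A => [[]//|n IHn] i A mA cA.
have mB : measurable (@cons_rV R n @^-1` A).
  by rewrite -[X in measurable X]setTI; exact: measurable_cons_rV.
have consDl t w : cons_rV (t, w) =
    cons_rV (0, w) + t *: delta_mx 0 0 :> 'rV[R]_n.+1.
  apply/rowP => k; rewrite !mxE /=; case: unliftP => [j ->|->] /=.
    by rewrite mulr0 addr0.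
  by rewrite mulr1 add0r.
have consDr t s w j : cons_rV (t, w + s *: delta_mx 0 j) =
    cons_rV (t, w) + s *: delta_mx 0 (lift ord0 j) :> 'rV[R]_n.+1.
  apply/rowP => k; rewrite !mxE /=; case: unliftP => [l ->|->] /=.
    by rewrite !mxE /= (inj_eq (@lift_inj _ _)).
  by rewrite mulr0 addr0.
case: (unliftP ord0 i) cA => [j ->|->] cA.
  (* Here [i] is not the first coordinate: the slice at each fixed first coordinate [t] is null by
     induction in the direction [j]. *)
  rewrite /= /pushforward /product_measure1.
  apply: integral0_eq => t _ /=; apply: (IHn j).
    exact: measurable_xsection.
  move=> w; have := cA (cons_rV (t, w)); congr countable.
  by apply/funext => s; rewrite xsectionE /= -consDr.
(* Here [i] is the first coordinate, which must be integrated first. Uniqueness of the product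
   measure exchanges the order, and the slices are then countable subsets of the line. *)
transitivity ((lebesgue_measure \x^ @lebesgue_rV R n)%E (@cons_rV R n @^-1` A)).
  apply: (@product_measure_unique _ _ _ _ R lebesgue_measure (@lebesgue_rV R n))
    => // B C mB' mC.
  exact: product_measure2E.
apply: integral0_eq => w _ /=.
apply: (@countable_lebesgue_measure0 R).
suff -> : ysection (@cons_rV R n @^-1` A) w =
  [set t | A (cons_rV (0, w) + t *: delta_mx 0 0)] by exact: cA.
by apply/funext => t; rewrite ysectionE /= consDl.
Qed.

(** Since [f x = 0], the difference quotient is [f (x + t *: e)] divided by [t]; its limit is
    nonzero, so it is nonzero for small [t != 0]. *)
Lemma derivable_isolated_zero (R : realType) (V : normedModType R)
    (f : V -> R) (x e : V) :
  derivable f x e -> f x = 0 -> 'D_e f x != 0 ->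
  \forall t \near (0 : R)^', f (x + t *: e) != 0.
Proof.
move=> fx f0 Df.
apply: filterS (cvgr_neq0 _ fx Df) => t /=.
by apply: contra_neq => ft0; rewrite (addrC (t *: e)) ft0 f0 subrr scaler0.
Qed.

(** Every point of this set of reals is isolated in it, and such a set is countable. *)
Lemma zeros_transverse_countable (R : realType) (V : normedModType R)
    (f : V -> R) (x e : V) :
  countable [set t : R | [/\ f (x + t *: e) = 0,
    derivable f (x + t *: e) e & 'D_e f (x + t *: e) != 0]].
Proof.
set S := mkset _.
suff -> : S = isolated S by exact: countable_isolated.
apply/seteqP; split => [t St|]; last exact: isolatedS.
split; first exact: mem_set.
have [f0 df Df] := St.
have /nbhs_ballP[r /= r0 rS] := derivable_isolated_zero df f0 Df.
exists (ball t r); first exact: nbhsx_ballx.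
apply/seteqP; split => [s [ts [fs _ _]]|_ ->]; last first.
  by split => //; exact: ballxx.
apply: contrapT => /eqP st.
suff : f (x + t *: e + (s - t) *: e) != 0.
  by rewrite -addrA -scalerDl (addrC t) subrK fs eqxx.
apply: rS; last by rewrite subr_eq0.
by move: ts; rewrite /ball /= sub0r normrN distrC.
Qed.

Lemma enorm_ge_coord (R : realType) (n : nat) (x : 'rV[R]_n) (i : 'I_n) :
  `|x 0 i| <= enorm x.
Proof.
rewrite -sqrtr_sqr ler_sqrt /enorm /dotmul; last first.
  by apply: sumr_ge0 => j _; rewrite -expr2 sqr_ge0.
rewrite (bigD1 i) //= -expr2 lerDl.
by apply: sumr_ge0 => j _; rewrite -expr2 sqr_ge0.
Qed.

Lemma enorm_continuous (R : realType) (n : nat) :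
  continuous (@enorm R n).
Proof.
move=> x; apply: continuous_comp; last exact: sqrt_continuous.
rewrite /dotmul; apply: (@cvg_big _ _ _ _ _ _ _ (nbhs x)) => [|i _].
  exact: add_continuous.
by apply: cvgM; exact: coord_continuous.
Qed.

(** The Hoelder bound on a compact ball around [x] inside [U] gives continuity at [x]. This is what
    makes the set where a partial derivative is nonzero open, hence measurable. *)
Lemma C1_holder_loc_partial_continuous (R : realType) (n : nat)
    (U : set 'rV[R]_n) (a : R) (v : 'rV[R]_n -> R) (i : 'I_n) (x : 'rV[R]_n) :
  0 < a -> open U -> C1_holder_loc U a v -> U x ->
  {for x, continuous (partial i v)}.
Proof.
move=> a0 oU [_ vH] Ux.
have /nbhs_closedballP[r rU] : nbhs x U by exact: open_nbhs_nbhs.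
have /vH/(_ rU)[C HC] : compact (closed_ball x r%:num).
  apply: bounded_closed_compact; last exact: closed_ball_closed.
  exists (`|x| + r%:num); split; first exact: num_real.
  move=> M rM y; rewrite closed_ballE// /closed_ball_ /= => xy.
  apply: le_trans (ltW rM).
  rewrite -[y](subKr x) (le_trans (ler_normB _ _))// lerD2l.
  exact: xy.
apply/(@cvgrPdist_lt _ _ _ (nbhs x)) => e e0.
have C1 : 0 < `|C| + 1 by rewrite ltr_wpDl.
(* Chosen so that [d] to the power [a] is [e / (|C| + 1)], which makes the Hoelder bound less than
   [e]. The sign of [C] is unknown, hence [|C| + 1]. *)
pose d := (e / (`|C| + 1)) `^ a^-1.
have d0 : 0 < d by rewrite powR_gt0// divr_gt0.
have near_d : \forall y \near x, enorm (x - y) < d.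
  have : enorm (x - y) @[y --> x] --> enorm (x - x).
    apply: (@cvg_comp _ _ _ (fun y => x - y) (@enorm R n) _ (nbhs (x - x))).
      by apply: (@cvgB _ _ _ (nbhs x) _ (cst x) id);
        [exact: cvg_cst|exact: cvg_id].
    exact: enorm_continuous.
  have -> : enorm (x - x) = 0.
    by rewrite subrr /enorm /dotmul big1 ?sqrtr0// => j _; rewrite mxE mul0r.
  move=> /cvgr0Pnorm_lt/(_ _ d0); apply: filterS => y.
  exact/le_lt_trans/ler_norm.
have near_r : \forall y \near x, closed_ball x r%:num y.
  by apply/nbhs_closedballP; exists r.
apply: filterS2 near_d near_r => y xyd xyr.
have xr : closed_ball x r%:num x by exact: closed_ballxx.
have := enorm_ge_coord (grad v x - grad v y) i; rewrite !mxE.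
move=> /le_lt_trans; apply.
apply: (le_lt_trans (HC x y xr xyr)).
apply: (@le_lt_trans _ _ (`|C| * enorm (x - y) `^ a)).
  by rewrite ler_wpM2r ?powR_ge0 ?ler_norm.
apply: (@le_lt_trans _ _ (`|C| * (e / (`|C| + 1)))).
  have -> : e / (`|C| + 1) = d `^ a.
    by rewrite -powRrM mulVf ?gt_eqF// powRr1// divr_ge0// ltW.
  rewrite ler_wpM2l// ge0_ler_powR ?nnegrE ?sqrtr_ge0 ?ltW//.
by rewrite mulrCA -[ltRHS]mulr1 ltr_pM2l// ltr_pdivrMr// mul1r ltrDl.
Qed.

(** A nonzero value would fix the sign of [v] near [x], against the adherence of [x] to the set of
    the opposite sign. *)
Lemma closure_pos_neg_eq0 (R : realType) (n : nat) (U : set 'rV[R]_n)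
    (v : 'rV[R]_n -> R) (x : 'rV[R]_n) :
  {for x, continuous v} ->
  closure [set y | U y /\ 0 < v y] x -> closure [set y | U y /\ v y < 0] x ->
  v x = 0.
Proof.
move=> cv clp clm; apply/eqP; rewrite eq_le; apply/andP; split.
  rewrite leNgt; apply/negP => vx.
  have [y [[_ vy0] vy]] := clm _ (cvgr_gt _ cv _ vx).
  by have := lt_trans vy0 vy; rewrite ltxx.
rewrite leNgt; apply/negP => vx.
have [y [[_ vy0] vy]] := clp _ (cvgr_lt _ cv _ vx).
by have := lt_trans vy0 vy; rewrite ltxx.
Qed.

Theorem corollary5p2 (R : realType) (N : nat) (Omega : set 'rV[R]_N)
    (p lp lm gamma : R) (u v : 'rV[R]_N -> R) :
  (0 < N)%N ->
  open Omega -> bounded_set Omega -> lipschitz_boundary Omega ->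
  1 < p -> 0 < lp -> 0 < lm ->
  0 < gamma < Num.min 1 (p * alpha_p N p / (1 + alpha_p N p)) ->
  local_minimizer Omega p lp lm gamma u ->
  C1_holder_representative Omega u v ->
  forall Omega' : set 'rV[R]_N, open Omega' -> compactly_contained Omega' Omega ->
    lebesgue_rV (Gamma_star Omega v `&` Omega') = 0%E.
Proof.
move=> _ oO _ _ _ _ _ _ _ [_ [a /andP[a0 _] vH]] O' oO' _.
have [dv _] := vH.
(* The part of the set where the [i]-th partial derivative is nonzero, so that one direction serves
   for all its points. [Omega] is paired with that condition because the partial derivatives are
   known to be continuous only there. *)
pose Z i := boundary [set x | Omega x /\ 0 < v x] `&`
  boundary [set x | Omega x /\ v x < 0] `&` O' `&`
  [set x | Omega x /\ partial i v x != 0].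
have mZ i : measurable (Z i).
  apply: measurableI; [apply: measurableI; [apply: measurableI|]|].
  - exact: boundary_measurable.
  - exact: boundary_measurable.
  - exact: open_measurable_rV.
  apply: open_measurable_rV; rewrite openE => x [Ox px].
  have px' := C1_holder_loc_partial_continuous a0 oO vH Ox (i := i).
  apply: filterI; first exact: open_nbhs_nbhs.
  exact: (cvgr_neq0 _ px' px).
have Z0 i : lebesgue_rV (Z i) = 0%E.
  apply: (lebesgue_rV_countable_lines (i := i)) => // x.
  (* Along a line in direction [i], points of [Z i] are zeros of [v] with nonzero derivative in that
     direction. *)
  apply: sub_countable (zeros_transverse_countable v x (delta_mx 0 i)).
  apply: subset_card_le => t [[[[cp _] [cm _]] _] [Ot pt]].
  split => //; last exact/diff_derivable/dv.
  apply: closure_pos_neg_eq0 cp cm.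
  exact/differentiable_continuous/dv.
(* A gradient is nonzero exactly when one of its coordinates is. *)
have -> : Gamma_star Omega v `&` O' = \big[setU/set0]_(i < N) Z i.
  rewrite -bigcup_seq; apply/seteqP; split => x.
    move=> [[[[bp bm] /= gx] Ox] Ox'].
    have [i pi] : exists i, partial i v x != 0.
      apply/existsP; apply: contraNT gx => /existsPn p0.
      apply/eqP/rowP => i; rewrite !mxE; apply/eqP.
      by rewrite -[_ == _]negbK p0.
    by exists i => //=; rewrite mem_index_enum.
  move=> [i _ [[[bp bm] Ox'] [Ox pi]]]; split => //; split => //; split => //=.
  by apply: contraNneq pi => /rowP/(_ i); rewrite !mxE => ->.
apply/negligibleP; first exact: bigsetU_measurable.
elim/big_ind : _ => [|A B|i _]; first exact: negligible_set0.
  exact: negligibleU.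
exact/(negligibleP (@lebesgue_rV R N) (mZ i)).2/Z0.
Qed.
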